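(* Let $\Bbbk$ be a field, $V$ a vector space of dimension $d$ over $\Bbbk$, $G$ a subgroup of $\mathrm{GL}_d(\Bbbk)$ (acting on $V=\Bbbk^d$ in the usual way), and $Q = V\times G$. For $n\in\mathbb{Z}$ define a binary operation on $Q$ by $$(a,A)\circ_n (b,B) = (A^n b,\ A^n B A^{-n}),\qquad a,b\in V,\ A,B\in G.$$ Then for every $n\in\mathbb{Z}$ the algebraic system $(Q, \circ_m, m\in\mathbb{Z})$ satisfies the following axioms. 1) Left self-distributivity: for all $a,b,c\in V$ and $A,B,C\in G$, $$(a,A)\circ_n\big((b,B)\circ_n(c,C)\big) = \big((a,A)\circ_n(b,B)\big)\circ_n\big((a,A)\circ_n(c,C)\big).$$ 2) Left divisibility: for any $(a,A),(b,B)\in Q$ there is a unique $(u,X)\in Q$ such that $(a,A)\circ_n(u,X) = (b,B)$. *)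

(* Defs.v *)
From HB Require Import structures.
From mathcomp Require Import all_boot all_order all_algebra.
From mathcomp Require Import boolp.

Set Implicit Arguments.
Unset Strict Implicit.
Unset Printing Implicit Defensive.

Import GRing.Theory.
Local Open Scope ring_scope.

(* The group GL_d(k), for an arbitrary field k and any d, d = 0 included:
   {'GL_d[k]} needs a finite k, and {unit 'M[k]_d} moreover needs d > 0. *)
Record GL (k : fieldType) (d : nat) := MkGL {
  GLmx :> 'M[k]_d;
  GLmx_unit : GLmx \in unitmx
}.

HB.instance Definition _ (k : fieldType) (d : nat) := [isSub for @GLmx k d].
HB.instance Definition _ (k : fieldType) (d : nat) :=
  [Choice of GL k d by <:].

Section GLGroup.
Variables (k : fieldType) (d : nat).
Implicit Types A B C : GL k d.

Lemma GL_one_unit : (1%:M : 'M[k]_d) \in unitmx.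
Proof. exact: unitmx1. Qed.

Lemma GL_mul_unit A B : (A : 'M_d) *m B \in unitmx.
Proof. by rewrite unitmx_mul !GLmx_unit. Qed.

Lemma GL_inv_unit A : invmx A \in unitmx.
Proof. by rewrite unitmx_inv GLmx_unit. Qed.

Definition GL_one : GL k d := MkGL GL_one_unit.
Definition GL_mul A B : GL k d := MkGL (GL_mul_unit A B).
Definition GL_inv A : GL k d := MkGL (GL_inv_unit A).

Lemma GL_mulA : associative GL_mul.
Proof. by move=> A B C; apply: val_inj; exact: mulmxA. Qed.

Lemma GL_mul1 : left_id GL_one GL_mul.
Proof. by move=> A; apply: val_inj; exact: mul1mx. Qed.

Lemma GL_mulr1 : right_id GL_one GL_mul.
Proof. by move=> A; apply: val_inj; exact: mulmx1. Qed.

Lemma GL_mulV : left_inverse GL_one GL_inv GL_mul.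
Proof. by move=> A; apply: val_inj; exact: (mulVmx (GLmx_unit A)). Qed.

Lemma GL_mulrV : right_inverse GL_one GL_inv GL_mul.
Proof. by move=> A; apply: val_inj; exact: (mulmxV (GLmx_unit A)). Qed.

HB.instance Definition _ := isGroup.Build (GL k d)
  GL_mulA GL_mul1 GL_mulr1 GL_mulV GL_mulrV.

End GLGroup.

(* Integer powers in a group, after exprz, which is only for unit rings. *)
Definition expgz (gT : groupType) (x : gT) (n : int) : gT :=
  match n with
  | Posz m => (x ^+ m)%g
  | Negz m => (x ^- m.+1)%g
  end.

(* A subgroup of a possibly infinite group is a groupClosed predicate. Its
   membership is boolean, which is classically no restriction. *)
Lemma groupClosed_of_Prop (gT : groupType) (H : gT -> Prop) :
  H 1%g -> (forall x y, H x -> H y -> H (x * y)%g) ->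
  (forall x, H x -> H (x^-1)%g) ->
  exists G : groupClosed gT, forall x, x \in G <-> H x.
Proof.
move=> H1 HM HV; pose S : {pred gT} := [pred x | `[<H x>]].
have SM : mulg_closed S.
  by move=> x y /asboolP Hx /asboolP Hy; apply/asboolP; apply: HM.
have S1 : 1%g \in S by apply/asboolP.
have SV : invg_closed S by move=> x /asboolP Hx; apply/asboolP; apply: HV.
pose SG := GroupClosed.Pack (GroupClosed.Class
  (isInvClosed.Build gT S SV) (isMul1Closed.Build gT S S1)
  (isMulClosed.Build gT S SM)).
by exists SG => x; split => [/asboolP|Hx] //; apply/asboolP.
Qed.

Definition subgroup_elt (gT : groupType) (G : groupClosed gT) : Type :=
  {x : gT | x \in G}.

Lemma groupClosedP (gT : groupType) (G : groupClosed gT) : group_closed G.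
Proof. by split=> [|x y xG yG]; [exact: gpred1 | exact: gpredF]. Qed.

HB.instance Definition _ (gT : groupType) (G : groupClosed gT) :=
  SubChoice.on (subgroup_elt G).
HB.instance Definition _ (gT : groupType) (G : groupClosed gT) :=
  SubChoice_isSubGroup.Build gT _ (subgroup_elt G) (groupClosedP G).

Definition VG (k : fieldType) (d : nat) (G : groupClosed (GL k d)) : Type :=
  ('cV[k]_d * subgroup_elt G)%type.

Definition circ (k : fieldType) (d : nat) (G : groupClosed (GL k d))
    (n : int) (p q : VG G) : VG G :=
  let: (a, A) := p in
  let: (b, B) := q in
  (val (expgz A n) *m b, (expgz A n * B * expgz A (- n)%R)%g).

(* Main.v *)
Require Import Defs.
From mathcomp Require Import all_boot all_order all_algebra.

Set Implicit Arguments.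
Unset Strict Implicit.
Unset Printing Implicit Defensive.

Import GRing.Theory.
Local Open Scope ring_scope.

(** The group [G] acts on [V * G] by [g . (b, B) = (g b, g B g^-1)], and left
    translation by [(a, A)] under the [n]-th operation is the action of [A ^ n]
    ([circE]). Left divisibility follows, since each element of a group acts
    bijectively. For left self-distributivity, taking [n]-th powers commutes
    with conjugation, so the action of every [g] is an endomorphism of the
    [n]-th operation ([VGact_circ]); self-distributivity is the case
    [g = A ^ n]. *)

Lemma expgzN (gT : groupType) (x : gT) (n : int) :
  expgz x (- n) = ((expgz x n)^-1)%g.
Proof. by case: n => [[|m]|m] //=; rewrite ?expg0 ?invg1 ?invgK. Qed.

Lemma expgzJ (gT : groupType) (x y : gT) (n : int) :
  expgz (x ^ y)%g n = (expgz x n ^ y)%g.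
Proof. by case: n => m /=; rewrite ?conjVg conjXg. Qed.

Section Action.
Variables (k : fieldType) (d : nat) (G : groupClosed (GL k d)).
Implicit Types (g h : subgroup_elt G) (p q : VG G).

(** Conjugation is by [g^-1] because [B ^ h] is [h^-1 B h]: this makes the
    action a left one, matching the action on column vectors. *)
Definition VGact g p : VG G := (val g *m p.1, (p.2 ^ g^-1)%g).

Lemma VGact1 p : VGact 1%g p = p.
Proof. by case: p => b B; rewrite /VGact invg1 conjg1 mul1mx. Qed.

Lemma VGactM g h p : VGact (g * h)%g p = VGact g (VGact h p).
Proof. by rewrite /VGact /= -mulmxA invgM conjgM. Qed.

Lemma VGactK g : cancel (VGact g) (VGact g^-1%g).
Proof. by move=> p; rewrite -VGactM mulVg VGact1. Qed.

Lemma VGactVK g : cancel (VGact g^-1%g) (VGact g).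
Proof. by move=> p; rewrite -VGactM mulgV VGact1. Qed.

Lemma circE n p q : circ n p q = VGact (expgz p.2 n) q.
Proof.
by case: p q => [a A] [b B]; rewrite /circ /VGact expgzN conjgE invgK mulgA.
Qed.

(** By [expgzJ], the translation by [g . p] is the conjugate by [g] of the
    translation by [p], and the conjugating factor cancels against the [g]
    acting on the right operand. *)
Lemma VGact_circ n g p q :
  VGact g (circ n p q) = circ n (VGact g p) (VGact g q).
Proof.
by rewrite !circE /= expgzJ conjgE invgK -!VGactM -!mulgA mulVg mulg1.
Qed.

End Action.

Theorem theorem4p3 (k : fieldType) (d : nat) (G : groupClosed (GL k d))
    (n : int) :
  (forall (a b c : 'cV[k]_d) (A B C : subgroup_elt G),
     circ n (a, A) (circ n (b, B) (c, C))
     = circ n (circ n (a, A) (b, B)) (circ n (a, A) (c, C)))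
  /\
  (forall (a b : 'cV[k]_d) (A B : subgroup_elt G),
     exists! uX : VG G, circ n (a, A) uX = (b, B)).
Proof.
split=> [a b c A B C | a b A B].
  by rewrite !(circE n (a, A)) VGact_circ.
exists (VGact (expgz A n)^-1%g (b, B)); split=> [|q].
  by rewrite circE VGactVK.
by rewrite circE => <-; rewrite VGactK.
Qed.
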